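(* Let $E_1|H_1,\ldots,E_{n+1}|H_{n+1}$ be $n+1$ arbitrary conditional events, with $n\geq 1$. Then the conjunctions $\mathcal{C}_n=\bigwedge_{i=1}^n(E_i|H_i)$ and $\mathcal{C}_{n+1}=\bigwedge_{i=1}^{n+1}(E_i|H_i)$ satisfy $\mathcal{C}_{n+1}\leq\mathcal{C}_n$.
   Context: Events are two-valued propositions (identified with subsets of the sure event $\Omega$, and with their indicators); $\overline{A}$ is negation, $AB$ is conjunction. For events $E,H$ with $H\neq\emptyset$, the conditional event $E|H$ is true if $EH$ is true, false if $\overline{E}H$ is true, void if $\overline{H}$ is true. A conditional random quantity $X|H$ ($X$ with finitely many values, $H\ne\emptyset$) with assessed prevision $\mu=\mathbb{P}(X|H)$ is identified with the random quantity $XH+\mu\overline{H}$; in particular $E|H=EH+x\overline{H}$ with $x=P(E|H)$. Coherence: an assessment of previsions $\mu_j=\mathbb{P}(X_j|K_j)$ on a family of conditional random quantities is coherent if, for every finite subfamily $\{X_1|K_1,\ldots,X_r|K_r\}$ and all real $s_1,\ldots,s_r$, the gain $G=\sum_j s_jK_j(X_j-\mu_j)$ restricted to $K_1\vee\cdots\vee K_r$ satisfies $\min G\leq 0\leq\max G$. Conjunction. Given conditional events $E_1|H_1,\ldots,E_N|H_N$, for each nonempty $S\subseteq\{1,\ldots,N\}$ let $x_S$ be the assessed prevision of $\mathcal{C}_S=\bigwedge_{i\in S}(E_i|H_i)$ ($x_{\{i\}}=P(E_i|H_i)$). $\mathcal{C}_S$ is the random quantity, conditional on $\bigvee_{i\in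 S}H_i$, with value $1$ if all $E_i|H_i$, $i\in S$, are true; $0$ if at least one is false; $x_V$ if none is false and the set $V\subseteq S$ of indices of void ones is nonempty (so its value is its prevision $x_S$ when all $H_i$, $i\in S$, are false). Convention: the numbers $x_S$ always form a coherent assessment on the family of all $\mathcal{C}_S$, and inequalities between compounds are pointwise inequalities of random quantities on $\Omega$, for every such coherent assessment. *)

(* Defs.v *)
From HB Require Import structures.
From mathcomp Require Import all_boot all_order all_algebra finmap.
From mathcomp Require Import boolp classical_sets reals numfun.

Set Implicit Arguments.
Unset Strict Implicit.
Unset Printing Implicit Defensive.

Import Order.TTheory GRing.Theory Num.Theory.

Local Open Scope classical_set_scope.
Local Open Scope ring_scope.

(* The conditional event E|H; the sure event is the type Omega and events are
   its subsets. *)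
Record cond_event (Omega : Type) := CondEvent {
  ce_event : set Omega;
  ce_cond : set Omega;
  ce_cond_neq0 : ce_cond !=set0 }.

Definition ce_true Omega (A : cond_event Omega) : set Omega :=
  ce_event A `&` ce_cond A.

Definition ce_false Omega (A : cond_event Omega) : set Omega :=
  ~` ce_event A `&` ce_cond A.

Definition ce_void Omega (A : cond_event Omega) : set Omega := ~` ce_cond A.

Section Coherence.
Variables (R : realType) (Omega : Type) (I : choiceType).

(* A family, indexed by I, of conditional random quantities X j | K j with
   assessed previsions mu j. Only finite-valued X j and nonempty K j are meant:
   the gains then have finitely many values, so that the extrema required by
   [coherent] exist. *)
Variables (X : I -> Omega -> R) (K : I -> set Omega) (mu : I -> R).

Definition gain (J : {fset I}) (s : I -> R) (w : Omega) : R :=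
  \sum_(j <- J) s j * \1_(K j) w * (X j w - mu j).

(* Coherence of the assessment on the subfamily indexed by D. The empty
   subfamily J is left out: its gain has an empty restricted domain, hence no
   extrema. *)
Definition coherent (D : set I) : Prop :=
  forall (J : {fset I}) (s : I -> R), J != fset0 -> [set` J] `<=` D ->
  let G := gain J s @` \bigcup_(j in [set` J]) K j in
  (exists2 m, (G `&` lbound G) m & m <= 0) /\
  (exists2 M, (G `&` ubound G) M & 0 <= M).

End Coherence.

Section Conjunction.
Variables (R : realType) (Omega : Type) (N : nat).
Variable A : 'I_N -> cond_event Omega.

(* x S is the assessed prevision of the conjunction over S, for S nonempty;
   x at the empty set is irrelevant. *)
Variable x : {set 'I_N} -> R.

Definition void_set (S : {set 'I_N}) (w : Omega) : {set 'I_N} :=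
  [set i in S | w \in ce_void (A i)]%SET.

(* If every i in S is void at w, the value is x S, so that this is already the
   identification of X|K with the quantity equal to X on K and to its prevision
   off K, for K = conj_cond S. *)
Definition conj_rq (S : {set 'I_N}) (w : Omega) : R :=
  if [forall i in S, w \in ce_true (A i)] then 1
  else if [exists i in S, w \in ce_false (A i)] then 0
  else x (void_set S w).

Definition conj_cond (S : {set 'I_N}) : set Omega :=
  \bigcup_(i in [set` S]) ce_cond (A i).

Definition conj_coherent : Prop :=
  coherent conj_rq conj_cond x [set S : {set 'I_N} | S != finset.set0].

End Conjunction.

(* Main.v *)
Require Import Defs.
From mathcomp Require Import all_boot all_order all_algebra.
From mathcomp Require Import boolp classical_sets reals.
From mathcomp Require Import finmap numfun lra.

Import Order.TTheory GRing.Theory Num.Theory.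

(** Once the conjunction C_S is read as a random quantity on the whole of
    Omega, equal to its prevision x_S when all its conditioning events fail, a
    gain is simply the sum of the s_j (C_j - x_j), the conditioning events
    having disappeared ([gain_conjE]).  Coherence therefore says that any
    linear combination of the C_S is somewhere at least equal to the same
    combination of the x_S, and moreover at a point where one of the
    conditioning events involved holds ([coherent_ge0]).

    At such a point not all members of S are void, so C_S takes there either
    the value 0 or 1, or the prevision x_V of a conjunction over a strictly
    smaller V.  This makes induction on #|S| possible: pointwise properties of
    the C_V follow from properties of the previsions, and properties of the
    previsions x_S follow by coherence from pointwise properties at points
    where only smaller previsions occur.  This loop yields first
    0 <= x_S <= 1 ([prevision_itv]), then x_S <= x_T for every nonempty subset
    T of S ([prevision_le]).

    The pointwise inequality C_S <= C_T then follows by cases: if S has a false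
    member, the left side is 0; if all members of S are true, both sides are 1;
    otherwise the left side is x_V, where V collects the void members of S, and
    the right side is 1 if V misses T, and the prevision over V :&: T if not
    ([conj_rq_le_void]). *)

Local Open Scope ring_scope.

(** Applied to the opposite stakes - s, this also recovers the half of coherence
    about the minimum of the gain. *)
Lemma coherent_ge0 (R : realType) (Omega : Type) (I : choiceType)
    (X : I -> Omega -> R) (K : I -> set Omega) (mu : I -> R) (D : set I)
    (J : {fset I}) (s : I -> R) :
  coherent X K mu D -> J != fset0 -> (forall j, j \in J -> D j) ->
  exists w, (exists2 j, j \in J & K j w) /\ 0 <= gain X K mu J s w.
Proof.
move=> coh J0 JD.
have [_ [M [[w [j jJ Kjw] <-] _] M_ge0]] := coh J s J0 JD.
by exists w; split=> //; exists j.
Qed.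

Arguments coherent_ge0 {R Omega I X K mu D}.

Section Conjunction.
Variables (R : realType) (Omega : Type) (N : nat).
Variables (A : 'I_N -> cond_event Omega) (x : {set 'I_N} -> R).
Implicit Types (S T V : {set 'I_N}) (w : Omega).

Local Notation C := (conj_rq A x).
Local Notation void := (void_set A).
Local Notation K := (conj_cond A).

Lemma cond_event_cases w i :
  [\/ w \in ce_true (A i), w \in ce_false (A i) | w \in ce_void (A i)].
Proof.
rewrite !in_setE /ce_true /ce_false /ce_void.
have [H|H] := pselect (ce_cond (A i) w); last exact: Or33.
have [E|E] := pselect (ce_event (A i) w); first exact: Or31.
exact: Or32.
Qed.

Lemma ce_true_void w i : w \in ce_true (A i) -> w \notin ce_void (A i).
Proof. by rewrite in_setE => -[_ H]; rewrite notin_setE /ce_void; apply. Qed.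

Lemma ce_false_void w i : w \in ce_false (A i) -> w \notin ce_void (A i).
Proof. by rewrite in_setE => -[_ H]; rewrite notin_setE /ce_void; apply. Qed.

Lemma ce_false_true w i : w \in ce_false (A i) -> w \notin ce_true (A i).
Proof.
by rewrite in_setE => -[nE _]; rewrite notin_setE /ce_true => -[]/nE.
Qed.

Lemma void_setS S T w : T \subset S -> void T w \subset void S w.
Proof.
move=> /fintype.subsetP TS; apply/fintype.subsetP => i.
by rewrite !inE => /andP[/TS -> ->].
Qed.

Variant conj_rq_spec S w : R -> Type :=
| ConjTrue of (forall i, i \in S -> w \in ce_true (A i)) : conj_rq_spec S w 1
| ConjFalse i of i \in S & w \in ce_false (A i) : conj_rq_spec S w 0
| ConjVoid of (forall i, i \in S -> w \notin ce_false (A i))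
    & void S w != finset.set0 : conj_rq_spec S w (x (void S w)).

Lemma conj_rqP S w : conj_rq_spec S w (C S w).
Proof.
rewrite /conj_rq; case: ifPn => [/'forall_implyP|noT].
  exact: ConjTrue.
case: ifPn => [/exists_inP/sig2W[i iS iF]|noF]; first exact: (ConjFalse _ _ i).
have nF i : i \in S -> w \notin ce_false (A i).
  by move=> iS; apply: contra noF => iF; apply/exists_inP; exists i.
apply: ConjVoid => //.
move: noT; rewrite negb_forall_in => /exists_inP[i iS iT].
apply/finset.set0Pn; exists i; rewrite inE iS /=.
by case: (cond_event_cases w i) iT (nF i iS) => // ->.
Qed.

Lemma conj_rq_off S w : S != finset.set0 -> ~ K S w -> C S w = x S.
Proof.
move=> /finset.set0Pn[i iS] nK.
have allV j : j \in S -> w \in ce_void (A j).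
  by move=> jS; rewrite in_setE => Kj; apply: nK; exists j.
case: conj_rqP => [aT|j jS jF|_ _].
- by have := ce_true_void _ _ (aT i iS); rewrite allV.
- by have := ce_false_void _ _ jF; rewrite allV.
- congr x; apply/setP => j; rewrite inE.
  by case jS: (j \in S) => //=; rewrite allV.
Qed.

(** Where the conditioning event of C_S holds, C_S can only refer to previsions
    of smaller conjunctions: this is what makes the inductions on #|S| work. *)
Lemma card_void S w : K S w -> (#|void S w| < #|S|)%N.
Proof.
case=> i iS Ki; apply/proper_card/properP; split.
  by apply/fintype.subsetP => j; rewrite inE => /andP[].
by exists i => //; rewrite inE iS /=; apply/negP; rewrite in_setE => /(_ Ki).
Qed.

(** The indicators of the conditioning events are redundant, since C_S = x_S
    where the conditioning event of C_S fails. *)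
Lemma gain_conjE (J : {fset {set 'I_N}}) (s : {set 'I_N} -> R) w :
  (forall S, S \in J -> S != finset.set0) ->
  gain C K x J s w = \sum_(S <- J) s S * (C S w - x S).
Proof.
move=> J0; rewrite /gain; apply: eq_big_seq => S SJ; rewrite indicE.
have [SK|] := boolP (w \in K S); first by rewrite mulr1.
by rewrite notin_setE => SK; rewrite conj_rq_off ?J0// subrr !mulr0.
Qed.

(** [0 <= x V <= 1] is only asked of the one prevision that C_S may take as its
    value at w, so that this applies inside the induction on #|S|. *)
Lemma conj_rq_itv_void S w :
  (void S w != finset.set0 -> 0 <= x (void S w) <= 1) -> 0 <= C S w <= 1.
Proof. by case: conj_rqP => [_|i _ _|_ V0 /(_ V0)//] _; rewrite ?lexx ?ler01. Qed.

(** The case of a void set V of S that meets T is left as a hypothesis on the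
    previsions over V and V :&: T, so that this serves both inside the induction
    proving [prevision_le], at points where V is smaller than S, and after it,
    at all points. *)
Lemma conj_rq_le_void S T w : T \subset S ->
  (forall V, V != finset.set0 -> 0 <= x V <= 1) ->
  (void T w != finset.set0 -> x (void S w) <= x (void T w)) -> C S w <= C T w.
Proof.
move=> TS x01 xV; case: (conj_rqP S w) => [aT|i iS iF|nF V0].
- case: conj_rqP => [//|i iT iF|_ /finset.set0Pn[i]].
  + by have := ce_false_true _ _ iF; rewrite aT// (fintype.subsetP TS).
  + rewrite inE => /andP[iT]; apply: contraLR => _; apply: ce_true_void.
    by rewrite aT// (fintype.subsetP TS).
- by have /andP[] := conj_rq_itv_void T w (x01 _).
- case: conj_rqP => [_|i iT iF|_ /xV//].
  + by have /andP[] := x01 _ V0.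
  + by have := nF i (fintype.subsetP TS i iT); rewrite iF.
Qed.

Hypothesis cohx : conj_coherent A x.

Lemma coherent_conj1 (s : R) S : S != finset.set0 ->
  exists2 w, K S w & 0 <= s * (C S w - x S).
Proof.
move=> S0.
have J0 V : V \in [fset S]%fset -> V != finset.set0 by rewrite in_fset1 => /eqP->.
have [|w [[V]]] := coherent_ge0 [fset S]%fset (fun=> s) cohx _ J0.
  by apply/fset0Pn; exists S; rewrite in_fset1.
rewrite in_fset1 => /eqP-> KS; rewrite gain_conjE// big_seq_fset1 => ge0.
by exists w.
Qed.

(** Since T is a subset of S, the conditioning event of C_T implies that of C_S,
    which is why the point can be taken in the latter. *)
Lemma coherent_conj2 S T : S != T -> S != finset.set0 -> T != finset.set0 ->
  T \subset S -> exists2 w, K S w & x S - x T <= C S w - C T w.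
Proof.
move=> ST S0 T0 TS.
have J0 V : V \in [fset S; T]%fset -> V != finset.set0.
  by rewrite in_fset2 => /orP[]/eqP->.
pose s V : R := if V == S then 1 else -1.
have [|w [[V]]] := coherent_ge0 [fset S; T]%fset s cohx _ J0.
  by apply/fset0Pn; exists S; rewrite in_fset2 eqxx.
rewrite in_fset2 => VST KV; rewrite gain_conjE//.
rewrite big_fsetU1 ?in_fset1// big_seq_fset1 /s eqxx eq_sym (negbTE ST) => ge0.
exists w; last by move: ge0 => /=; lra.
move: VST KV => /orP[]/eqP-> // [i iT Ki].
by exists i => //=; exact: (fintype.subsetP TS).
Qed.

Lemma prevision_itv S : S != finset.set0 -> 0 <= x S <= 1.
Proof.
have [n] := ubnP #|S|; elim: n S => // n IHn S; rewrite ltnS => Sn S0.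
have C01 w : K S w -> 0 <= C S w <= 1.
  move=> KS; apply: conj_rq_itv_void; apply: IHn.
  exact: leq_trans (card_void _ _ KS) Sn.
have [u /C01/andP[Cu _] xu] := coherent_conj1 (-1) S S0.
have [v /C01/andP[_ Cv] xv] := coherent_conj1 1 S S0.
by apply/andP; split; [move: Cu xu|move: Cv xv]; lra.
Qed.

Lemma prevision_le S T : T != finset.set0 -> T \subset S -> x S <= x T.
Proof.
have [n] := ubnP #|S|; elim: n S T => // n IHn S T; rewrite ltnS => Sn T0 TS.
have [->//|ST] := eqVneq S T.
have S0 : S != finset.set0.
  by apply: contraNneq T0 => S0; rewrite -finset.subset0 -S0.
have [w KS xST] := coherent_conj2 S T ST S0 T0 TS.
(* The point w lies in the conditioning event of C_S, so the induction
   hypothesis gives the pointwise inequality there. *)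
suff : C S w <= C T w by move: xST; lra.
apply: conj_rq_le_void => //; first exact: prevision_itv.
move=> VT0; apply: IHn => //; last exact: void_setS.
exact: leq_trans (card_void _ _ KS) Sn.
Qed.

Theorem conj_rq_le S T w : T \subset S -> C S w <= C T w.
Proof.
move=> TS; apply: conj_rq_le_void => //; first exact: prevision_itv.
by move=> VT0; apply: prevision_le => //; exact: void_setS.
Qed.

End Conjunction.

Theorem theorem7 (R : realType) (Omega : Type) (n : nat) (hn : (1 <= n)%N)
    (A : 'I_n.+1 -> cond_event Omega) (x : {set 'I_n.+1} -> R)
    (hx : conj_coherent A x) (w : Omega) :
  conj_rq A x [set: 'I_n.+1]%SET w <=
  conj_rq A x [set i : 'I_n.+1 | (i < n)%N]%SET w.
Proof. by apply: conj_rq_le => //; exact: finset.subsetT. Qed.
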